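(* For any integer $t\geq 0$, there exist a graph $H=(V,E)$ and an edge $e\in E$ such that $\operatorname{ppt}(H/e)\geq \operatorname{ppt}(H)+t$, where $H/e$ is the graph obtained from $H$ by contracting the edge $e$.
   Context: All graphs are finite and simple. For an edge $e=uv$ of $H$, the graph $H/e$ obtained by contracting $e$ results from identifying $u$ and $v$ as a single vertex $w$ with $N(w)=(N(u)\cup N(v))\setminus\{u,v\}$. For a graph $G$ and $S\subseteq V(G)$, let $N(v)$ be the set of neighbors of $v$ and $N[S]=S\cup\bigcup_{s\in S}N(s)$. Define $S^{[0]}=S$, $S^{[1]}=N[S]$, and for $i\geq 1$, $S^{[i+1]}=S^{[i]}\cup\{w\in V(G) : \exists\, v\in S^{[i]},\ N(v)\setminus S^{[i]}=\{w\}\}$. The set $S$ is a power dominating set of $G$ if $S^{[\ell]}=V(G)$ for some $\ell$; a minimum power dominating set is one of minimum cardinality. For a power dominating set $S$, $\operatorname{ppt}(G,S)$ is the smallest $\ell\ge 0$ with $S^{[\ell]}=V(G)$. The power propagation time of $G$ is $\operatorname{ppt}(G)=\min\{\operatorname{ppt}(G,S) : S \text{ is a minimum power dominating set of } G\}$. *)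

(* Defs.v *)
From mathcomp Require Import all_boot.
From mathcomp Require Import boolp.

Set Implicit Arguments.
Unset Strict Implicit.
Unset Printing Implicit Defensive.

Record sgraph := SGraph {
  vertex :> finType;
  adj : rel vertex;
  adj_sym : symmetric adj;
  adj_irrefl : irreflexive adj
}.

Definition nbrs (G : sgraph) (v : G) : {set G} := [set w | adj v w].

Definition closed_nbrs (G : sgraph) (S : {set G}) : {set G} :=
  S :|: \bigcup_(s in S) nbrs s.

(* [power_iter S i] is S^[i]; the domination step S^[1] = N[S] is followed by
   forcing steps only. *)
Fixpoint power_iter (G : sgraph) (S : {set G}) (i : nat) : {set G} :=
  match i with
  | 0 => S
  | 1 => closed_nbrs S
  | j.+1 =>
      let X := power_iter S j in
      X :|: [set w | [exists v in X, nbrs v :\: X == [set w]]]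
  end.

Definition power_dominating (G : sgraph) (S : {set G}) : Prop :=
  exists l, power_iter S l == [set: G].

Definition minimum_power_dominating (G : sgraph) (S : {set G}) : Prop :=
  power_dominating S /\
  forall S' : {set G}, power_dominating S' -> #|S| <= #|S'|.

(* The value does not depend on the proof [pdS]. *)
Definition ppt_set (G : sgraph) (S : {set G}) (pdS : power_dominating S) : nat :=
  ex_minn pdS.

Lemma minimum_power_dominating_exists (G : sgraph) :
  exists S : {set G}, minimum_power_dominating S.
Proof.
have pdT : `[< @power_dominating G [set: G] >] by apply/asboolP; exists 0.
case: (arg_minnP (P := fun S : {set G} => `[< power_dominating S >])
                 (fun S => #|S|) pdT) => S /asboolP pdS minS.
by exists S; split=> // S' pdS'; apply: minS; apply/asboolP.
Qed.

Definition attains_ppt (G : sgraph) (k : nat) : Prop :=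
  exists (S : {set G}) (pdS : power_dominating S),
    minimum_power_dominating S /\ ppt_set pdS = k.

Lemma attains_ppt_exists (G : sgraph) : exists k, `[< attains_ppt G k >].
Proof.
have [S minS] := minimum_power_dominating_exists G.
by exists (ppt_set minS.1); apply/asboolP; exists S, minS.1.
Qed.

Definition ppt (G : sgraph) : nat := ex_minn (attains_ppt_exists G).

Section Contraction.
Variables (H : sgraph) (u v : H).

(* [None] is the vertex w obtained by identifying u and v. *)
Definition contract_vertex : finType := option {x : H | x \notin [set u; v]}.

Definition contract_adj (x y : contract_vertex) : bool :=
  match x, y with
  | Some a, Some b => adj (val a) (val b)
  | None, Some b => val b \in nbrs u :|: nbrs v
  | Some a, None => val a \in nbrs u :|: nbrs v
  | None, None => false
  end.

Lemma contract_adj_sym : symmetric contract_adj.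
Proof. by move=> [a|] [b|] //=; rewrite adj_sym. Qed.

Lemma contract_adj_irrefl : irreflexive contract_adj.
Proof. by move=> [a|] //=; rewrite adj_irrefl. Qed.

(* The contraction of the edge uv; meant to be used when [adj u v]. *)
Definition contract : sgraph := SGraph contract_adj_sym contract_adj_irrefl.

End Contraction.

(* Main.v *)
Require Import Defs.
From mathcomp Require Import all_boot.
From mathcomp Require Import boolp.

Set Implicit Arguments.
Unset Strict Implicit.
Unset Printing Implicit Defensive.

(** The idea is to let the contraction lower the power domination number from 2
    to 1, so that the contracted graph has to be observed from a single vertex,
    which takes long, while the two vertices available before the contraction
    finish at once.

    The graph H is a path (the spine) 0, 1, ..., t+2, with two leaves attached
    to spine vertex 0 and a hub joined to all the spine vertices but 0.  Vertex
    0 together with the hub dominates H, so ppt(H) <= 1 as soon as no single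
    vertex power dominates H.  That lower bound comes from two forts, sets that
    no forcing step can enter from outside: the pair of leaves, and the fan
    formed by the hub and the spine from 2 on.  A power dominating set meets the
    closed neighbourhood of every fort, and these two closed neighbourhoods are
    disjoint ([card_gt1_of_forts]).

    Contract the spine edge 01 to w.  Both forts survive, and w is now the only
    vertex close to both, so {w} is the only candidate for a power dominating
    singleton ([contract_pd_set1]).  It does power dominate: w observes the
    leaves, the hub and spine vertex 2, and then the spine is forced one vertex
    at a time.  The hub cannot speed this up, because it is adjacent to all the
    spine vertices still missing.  So the last spine vertex t+2 is reached at
    time t+1 exactly ([power_iter_merged]). *)

(** * Power propagation time *)

Lemma ppt_le (G : sgraph) (S : {set G}) (l : nat) :
  minimum_power_dominating S -> power_iter S l == [set: G] -> ppt G <= l.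
Proof.
move=> minS Sl; rewrite /ppt; case: ex_minnP => k _ kmin.
have pdS : power_dominating S by exists l.
apply: (@leq_trans (ppt_set pdS)).
  by apply: kmin; apply/asboolP; exists S, pdS.
by rewrite /ppt_set; case: ex_minnP => m _; apply.
Qed.

Lemma leq_ppt (G : sgraph) (k : nat) :
  (forall (S : {set G}) l,
     minimum_power_dominating S -> power_iter S l == [set: G] -> k <= l) ->
  k <= ppt G.
Proof.
move=> slow; rewrite /ppt.
case: ex_minnP => _ /asboolP [S [pdS [minS <-]]] _.
by rewrite /ppt_set; case: ex_minnP => m Sm _; apply: slow minS Sm.
Qed.

Lemma in_closed_nbrs (G : sgraph) (S : {set G}) (x : G) :
  reflect (x \in S \/ exists2 s, s \in S & adj s x) (x \in closed_nbrs S).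
Proof.
rewrite inE; apply: (iffP orP) => -[xS|]; try by left.
- by case/bigcupP => s sS; rewrite inE => sx; right; exists s.
- by case=> s sS sx; right; apply/bigcupP; exists s; rewrite // inE.
Qed.

(** * Forts *)

(** Equivalently, no vertex outside [F] has exactly one neighbour in [F]; the
    second neighbour is given explicitly because it is what blocks forcing. *)
Definition fort (G : sgraph) (F : {set G}) : Prop :=
  forall y z : G, y \notin F -> z \in F -> adj y z ->
  exists z', [/\ z' \in F, z' != z & adj y z'].

(** If [S] does not dominate any vertex of the fort, a first vertex of [F] to be
    observed would be the only unobserved neighbour of a vertex outside [F],
    whereas that vertex has a second neighbour in [F]. *)
Lemma fort_closed_nbrs (G : sgraph) (F S : {set G}) :
  fort F -> F != set0 -> power_dominating S ->
  exists2 s, s \in S & s \in closed_nbrs F.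
Proof.
move=> fortF /set0Pn [z zF] [l /eqP Sl]; apply: contrapT => noS.
have far s : s \in S -> s \notin closed_nbrs F.
  by move=> sS; apply/negP => sF; apply: noS; exists s.
have SF k : {in F, forall y, y \notin power_iter S k}.
  elim: k => [|[_|k IHk]] y yF.
  - apply/negP => yS; case/negP: (far _ yS).
    by apply/in_closed_nbrs; left.
  - apply/negP => /in_closed_nbrs [yS|[s sS sy]].
      by case/negP: (far _ yS); apply/in_closed_nbrs; left.
    case/negP: (far _ sS); apply/in_closed_nbrs; right.
    by exists y; rewrite // adj_sym.
  - rewrite [power_iter _ _]/= -/(power_iter S k.+1).
    set X := power_iter S k.+1 in IHk *.
    rewrite inE (negPf (IHk _ yF)) inE /=.
    apply/existsP => -[x /andP [xX /eqP Nx]].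
    have xF : x \notin F by apply/negP => /IHk; rewrite xX.
    have xy : adj x y by move: (set11 y); rewrite -Nx !inE => /andP [].
    have [y' [y'F /negP y'y xy']] := fortF _ _ xF yF xy.
    by apply: y'y; rewrite -in_set1 -Nx !inE IHk.
by have := SF l z zF; rewrite Sl inE.
Qed.

Lemma card_gt1_of_forts (G : sgraph) (F1 F2 S : {set G}) :
  fort F1 -> fort F2 -> F1 != set0 -> F2 != set0 ->
  [disjoint closed_nbrs F1 & closed_nbrs F2] -> power_dominating S ->
  1 < #|S|.
Proof.
move=> f1 f2 n1 n2 dis pdS.
have [s1 s1S s1F] := fort_closed_nbrs f1 n1 pdS.
have [s2 s2S s2F] := fort_closed_nbrs f2 n2 pdS.
apply/card_gt1P; exists s1, s2; split=> //.
by apply/eqP => E; move: s1F; rewrite (disjointFl dis) // E.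
Qed.

(** * Forts under contraction *)

Section ContractFort.
Variables (G : sgraph) (u v : G).
Implicit Types F : {set G}.

Definition contract_set F : {set contract u v} :=
  [set y : contract u v | if y is Some a then val a \in F else false].

Lemma notin_merged F z :
  u \notin F -> v \notin F -> z \in F -> z \notin [set u; v].
Proof.
move=> uF vF zF; rewrite !inE; apply/norP.
by split; apply/negP => /eqP E; rewrite E ?(negPf uF) ?(negPf vF) in zF.
Qed.

(** The merged vertex has the neighbours of [u] and those of [v]; as soon as it
    has one in [F], so has [u] or [v], which then provides a second one. *)
Lemma contract_fort F :
  u \notin F -> v \notin F -> fort F -> fort (contract_set F).
Proof.
move=> uF vF fortF y [a|]; rewrite !inE // => yF aF.
have lift_F (x : G) : x \notin F -> adj x (val a) ->
    exists b : {x : G | x \notin [set u; v]},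
      [/\ val b \in F, b != a & adj x (val b)].
  move=> xF xa; have [z [zF za xz]] := fortF _ _ xF aF xa.
  have zuv := notin_merged uF vF zF.
  exists (exist _ z zuv); split=> //.
case: y yF => [c|] /=.
  move=> cF ca; have [b [bF ba cb]] := lift_F _ cF ca.
  by exists (Some b); split; rewrite ?inE.
move=> _; rewrite in_setU !in_set => /orP [ua|va].
  have [b [bF ba ub]] := lift_F _ uF ua.
  by exists (Some b); split; rewrite ?inE ?ub.
have [b [bF ba vb]] := lift_F _ vF va.
by exists (Some b); split; rewrite ?inE ?vb ?orbT.
Qed.

Lemma closed_nbrs_contract F (a : {x : G | x \notin [set u; v]}) :
  Some a \in closed_nbrs (contract_set F) -> val a \in closed_nbrs F.
Proof.
case/in_closed_nbrs => [|[[b|]]]; rewrite inE // => aF.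
  by apply/in_closed_nbrs; left.
by move=> ba; apply/in_closed_nbrs; right; exists (val b).
Qed.

(** Every vertex but the merged one keeps its neighbours in the forts, so only
    the merged vertex can be close to both forts. *)
Lemma contract_pd_set1 F1 F2 (S : {set contract u v}) :
  fort F1 -> fort F2 -> F1 != set0 -> F2 != set0 ->
  u \notin F1 -> v \notin F1 -> u \notin F2 -> v \notin F2 ->
  [disjoint closed_nbrs F1 & closed_nbrs F2] ->
  power_dominating S -> #|S| <= 1 -> S = [set None].
Proof.
move=> f1 f2 n1 n2 u1 v1 u2 v2 dis pdS /card_le1P S1.
have lift_neq0 F : u \notin F -> v \notin F -> F != set0 ->
    contract_set F != set0.
  move=> uF vF /set0Pn [z zF]; apply/set0Pn.
  have zuv := notin_merged uF vF zF.
  by exists (Some (exist _ z zuv)); rewrite inE.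
have [s sS sF1] :=
  fort_closed_nbrs (contract_fort u1 v1 f1) (lift_neq0 _ u1 v1 n1) pdS.
have [s' s'S s'F2] :=
  fort_closed_nbrs (contract_fort u2 v2 f2) (lift_neq0 _ u2 v2 n2) pdS.
have Es : s' = s by move: s'S; rewrite (S1 _ sS) inE => /eqP.
have sNone : s = None.
  rewrite Es {s' s'S Es} in s'F2; case: s sF1 s'F2 {sS} => // a.
  move=> /closed_nbrs_contract a1 /closed_nbrs_contract.
  by rewrite (disjointFr dis a1).
by apply/setP => y; rewrite (S1 _ sS) sNone !inE.
Qed.

End ContractFort.

(** * The graph *)

Section FanGraph.
Variable t : nat.

(** Off the spine: [Some b] is one of the two leaves, [None] is the hub. *)
Definition fan_vertex : finType := (option bool + 'I_t.+3)%type.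

Definition attached (o : option bool) (i : nat) : bool :=
  if o is Some _ then i == 0 else 0 < i.

Definition fan_adj (x y : fan_vertex) : bool :=
  match x, y with
  | inl _, inl _ => false
  | inl o, inr i | inr i, inl o => attached o i
  | inr i, inr j => (i.+1 == j) || (j.+1 == i)
  end.

Lemma fan_adj_sym : symmetric fan_adj.
Proof. by move=> [o|i] [o'|j] //=; rewrite orbC. Qed.

Lemma fan_adj_irrefl : irreflexive fan_adj.
Proof. by move=> [//|i] /=; rewrite orbb; apply: gtn_eqF. Qed.

Definition fan_graph : sgraph := SGraph fan_adj_sym fan_adj_irrefl.

Definition off (o : option bool) : fan_graph := inl o.
Definition spine (k : nat) : fan_graph := inr (inord k : 'I_t.+3).

Definition leaves : {set fan_graph} :=
  [set x : fan_graph | if x is inl (Some _) then true else false].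
Definition fan : {set fan_graph} :=
  [set x : fan_graph |
    match x with inl o => o == None | inr i => 1 < i end].

Lemma fort_leaves : fort leaves.
Proof.
move=> [o|i] [[b|]|j]; rewrite !inE // => _ _ i0.
by exists (off (Some (~~ b))); rewrite inE; split=> //; case: b {i0}.
Qed.

(** Spine vertex 1 is the only outside vertex next to the fan, and it is
    adjacent to the hub and to spine vertex 2. *)
Lemma fort_fan : fort fan.
Proof.
have v2 : 2 < t.+3 by [].
move=> [[b|//]|i] [[b'|]|j]; rewrite !inE //=.
- by move=> _ j1 /eqP j0; rewrite j0 in j1.
- rewrite -leqNgt => i1 _ i0; exists (inr (Ordinal v2)).
  by rewrite !inE; split=> //=; rewrite eqSS eqn_leq i1 i0.
- rewrite -leqNgt => i1 j1 ij; exists (off None).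
  rewrite !inE; split=> //=; case/orP: ij => /eqP E.
    by move: j1; rewrite -E.
  by rewrite -E.
Qed.

Lemma leaves_neq0 : leaves != set0.
Proof. by apply/set0Pn; exists (off (Some true)); rewrite inE. Qed.

Lemma fan_neq0 : fan != set0.
Proof. by apply/set0Pn; exists (off None); rewrite inE. Qed.

Lemma leaves_fan_disjoint : [disjoint closed_nbrs leaves & closed_nbrs fan].
Proof.
have near_leaves (x : fan_graph) : x \in closed_nbrs leaves ->
    match x with inl o => isSome o | inr i => i == 0 :> nat end.
  case/in_closed_nbrs => [|[[[b|]|k]]]; rewrite inE //.
  - by case: x => [[]|].
  - by case: x => [o|i].
have near_fan (x : fan_graph) : x \in closed_nbrs fan ->
    match x with inl o => o == None | inr i => 0 < i end.
  case/in_closed_nbrs => [|[y]]; rewrite inE; case: x => [[b|]|i] //.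
  - exact: ltnW.
  - by case: y => [//|k] k1 /eqP k0; rewrite k0 in k1.
  - by case: y => [o /eqP -> //|k k1 /= /orP [] /eqP E];
      [rewrite -E | move: k1; rewrite -E; case: (i : nat)].
rewrite disjoint_subset; apply/subsetP => x /near_leaves xl.
apply/negP => /near_fan; case: x xl => [[b|]|i] //=.
by rewrite lt0n => ->.
Qed.

Lemma ppt_fan_graph : ppt fan_graph <= 1.
Proof.
have dom : power_iter [set spine 0; off None] 1 == [set: fan_graph].
  apply/eqP/setP => x; rewrite [RHS]inE; apply/in_closed_nbrs.
  case: x => [[b|]|i].
  - by right; exists (spine 0); rewrite ?inE ?eqxx //= inordK.
  - by left; rewrite !inE eqxx orbT.
  have [i0|i_gt0] := posnP i.
    left; rewrite !inE; apply/orP; left; apply/eqP; congr inr.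
    by apply: val_inj; rewrite /= inordK.
  by right; exists (off None); rewrite ?inE ?eqxx ?orbT.
apply: (ppt_le _ dom); split; first by exists 1.
move=> S pdS; rewrite cards2.
exact: (card_gt1_of_forts fort_leaves fort_fan leaves_neq0 fan_neq0
          leaves_fan_disjoint pdS).
Qed.

(** * The contracted graph *)

Let G' : sgraph := contract (spine 0) (spine 1).

Definition spine_beyond (m : nat) : {set G'} :=
  [set y : G' | if y is Some a then
                  if val a is inr i then m < i else false
                else false].

Lemma off_unmerged o : off o \notin [set spine 0; spine 1].
Proof. by rewrite !inE. Qed.

Lemma spine_unmerged (i : 'I_t.+3) :
  1 < i -> (inr i : fan_graph) \notin [set spine 0; spine 1].
Proof.
move=> i1; rewrite !inE; apply/norP.
by split; apply/eqP => -[E]; move: i1; rewrite E inordK.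
Qed.

Lemma spine_unmerged_gt1 (i : 'I_t.+3) :
  (inr i : fan_graph) \notin [set spine 0; spine 1] -> 1 < i.
Proof.
apply: contraR; rewrite -leqNgt => i1; rewrite !inE.
case: (posnP i) => [i0|i_gt0]; apply/orP; [left|right]; apply/eqP; congr inr;
  apply: val_inj; rewrite /= inordK //.
by apply/eqP; rewrite eqn_leq i1.
Qed.

Definition spine' (i : 'I_t.+3) (i1 : 1 < i) : G' :=
  Some (exist _ (inr i : fan_graph) (spine_unmerged i1)).

Definition off' (o : option bool) : G' := Some (exist _ (off o) (off_unmerged o)).

Lemma contracted_vertexP (y : G') :
  [\/ y = None, exists o, y = off' o |
     exists (i : 'I_t.+3) (i1 : 1 < i), y = spine' i1].
Proof.
case: y => [[[o|i] xP]|]; last by constructor 1.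
  by constructor 2; exists o; congr Some; apply: val_inj.
constructor 3; exists i, (spine_unmerged_gt1 xP).
by congr Some; apply: val_inj.
Qed.

(** While at least two spine vertices are missing the hub cannot force, and the
    last observed spine vertex is the only one with a single missing neighbour;
    when one is missing, the hub and the spine agree on it.  The index is [j.+2]
    because the merged vertex stands for spine vertices 0 and 1, and dominates
    spine vertex 2 at time 1. *)
Lemma power_iter_merged j :
  power_iter [set (None : G')] j.+1 = ~: spine_beyond j.+2.
Proof.
have w_spine (i : 'I_t.+3) (i1 : 1 < i) :
    adj (None : G') (spine' i1) = (i == 2 :> nat).
  rewrite /= !inE /= !inordK // !(eq_sym _ (i : nat)) !orbF.
  by case: (i : nat) i1 => [|[|[|k]]].
elim: j => [|j IHj].
  apply/setP => y; apply/in_closed_nbrs/idP.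
    case=> [|[s]]; rewrite in_set1 => /eqP -> //; first by rewrite !inE.
    case: (contracted_vertexP y) => [->|[o ->]|[i [i1 ->]]];
      rewrite ?w_spine !inE //=.
    by move=> /eqP ->.
  case: (contracted_vertexP y) => [->|[o ->]|[i [i1 ->]]]; rewrite !inE /=.
  - by left.
  - right; exists (None : G'); rewrite ?inE //= !inE /= !inordK //.
    by case: o.
  - rewrite -leqNgt => i2; right; exists (None : G'); first by rewrite inE.
    by apply: etrans (w_spine _ _) _; rewrite eqn_leq i2.
rewrite [LHS]/= -/(power_iter [set (None : G')] j.+1) IHj.
apply/setP => y; rewrite inE.
case: (contracted_vertexP y) => [->|[o ->]|[i [i1 ->]]]; [by rewrite !inE..|].
have whiteE (m : nat) : (spine' i1 \in ~: spine_beyond m) = (i <= m).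
  by rewrite !inE /= -leqNgt.
rewrite !whiteE.
have [i_le|i_gt /=] := leqP i j.+2; first by rewrite leqW.
rewrite inE; apply/existsP/idP => [[x /andP [xX /eqP Nx]]|i_le].
  have : adj (x : G') (spine' i1).
    by move: (set11 (spine' i1)); rewrite -Nx in_setD => /andP [_]; rewrite in_set.
  case: (contracted_vertexP x) Nx xX => [->|[o ->]|[k [k1 ->]]] Nx xX.
  - by rewrite w_spine => /eqP i2; rewrite i2 in i_gt.
  - case: o Nx {xX} => [b _ /eqP i0|Nx _]; first by move: (i1); rewrite i0.
    (* The hub would have to force past spine vertex [j.+3], itself missing. *)
    rewrite leqNgt; apply/negP => i_gt3.
    have n_lt : j.+3 < t.+3 by apply: ltn_trans i_gt3 _.
    have n1 : 1 < Ordinal n_lt by [].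
    have : spine' n1 \in nbrs (off' None) :\: ~: spine_beyond j.+2.
      by rewrite !inE /= ltnSn.
    by rewrite Nx inE => /eqP [E]; rewrite -E ltnn in i_gt3.
  - move: xX; rewrite !inE /= -leqNgt => k_le /orP [/eqP <- //|/eqP E].
    by rewrite -E ltnNge (leq_trans _ i_gt) // in k_le.
have i_eq : i = j.+3 :> nat by apply/eqP; rewrite eqn_leq i_le.
(* The new vertex is forced by its predecessor on the spine. *)
have k_lt : j.+2 < t.+3 by apply: ltn_trans i_gt _.
have k1 : 1 < Ordinal k_lt by [].
exists (spine' k1); rewrite !inE /= ltnn /=; apply/eqP/setP => z.
rewrite in_setD in_set1.
case: (contracted_vertexP z) => [->|[o ->]|[n [n1 ->]]]; rewrite !inE //=.
rewrite negbK; apply/andP/eqP => [[n_gt /orP [/eqP E|/eqP E]]|[->]].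
- by congr Some; apply: val_inj; congr inr; apply: val_inj; rewrite /= i_eq.
- by rewrite -E ltnNge leqnSn in n_gt.
- by rewrite i_eq ltnSn eqxx.
Qed.

End FanGraph.

Theorem corollary18 (t : nat) :
  exists (H : sgraph) (u v : H),
    adj u v /\ ppt H + t <= ppt (contract u v).
Proof.
exists (fan_graph t), (spine t 0), (spine t 1); split.
  by rewrite /= !inordK.
apply: leq_trans (leq_add (ppt_fan_graph t) (leqnn t)) _; rewrite add1n.
have w_pd : power_dominating [set (None : contract (spine t 0) (spine t 1))].
  exists t.+1; rewrite power_iter_merged; apply/eqP/setP => y.
  rewrite !inE; case: y => [[[//|i] iP]|//] /=.
  by rewrite -leqNgt -ltnS ltn_ord.
apply: leq_ppt => S l [pdS minS]; rewrite ltnNge.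
have S1 : #|S| <= 1 by have := minS _ w_pd; rewrite cards1.
have -> : S = [set None].
  apply: (contract_pd_set1 (@fort_leaves t) (@fort_fan t) (leaves_neq0 t)
            (fan_neq0 t) _ _ _ _ (leaves_fan_disjoint t) pdS S1);
    by rewrite inE //= inordK.
apply: contraTN => lt; apply/eqP => /setP.
have t2 : 1 < (ord_max : 'I_t.+3) by [].
move/(_ (spine' t2)); rewrite [RHS]inE.
case: l lt => [|l] lt; first by rewrite !inE.
by rewrite power_iter_merged !inE /= -leqNgt leqNgt !ltnS lt.
Qed.
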